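(* Let $T_P$ be a finite set of predicate terms, $T_U$ a finite set of update terms, and $\varphi$ a HyperTSL formula whose predicate and update terms lie in $T_P$ and $T_U$. If the HyperLTL formula $\mathrm{transl}(\varphi)$ describes a pseudo hyperproperty (over traces over $AP=\{a_\tau:\tau\in T_P\cup T_U\}$), then $\varphi$ describes a pseudo hyperproperty (over sets of executions over $T_U$).
   Context: TSL setting. Let $\mathcal V$ be a set of values with Booleans $\mathbb B$. Fix inputs $\mathbb I$, a finite set of cells $\mathbb C$, function symbols $\Sigma_F$ and predicate symbols $\Sigma_P\subseteq\Sigma_F$. Function terms $\tau::=s\mid f\,\tau_1\cdots\tau_n$ ($s\in\mathbb I\cup\mathbb C$), forming $\mathcal T_F$; predicate terms $p\,\tau_1\cdots\tau_n$; update terms $[c\leftarrow\tau]$. An interpretation $\langle\cdot\rangle$ maps symbols to functions $\mathcal V^n\to\mathcal V$ (predicates into $\mathbb B$). A computation is an infinite sequence $\varsigma$ of total maps $\mathbb C\to\mathcal T_F$; an input stream is an infinite sequence $\iota$ of maps $\mathbb I\to\mathcal V$; an execution is $(\varsigma,\iota)$; it is over $T_U$ if $[c\leftarrow\varsigma(i)(c)]\in T_U$ for all $i,c$. With initial values $\mathrm{init}_c$, evaluation: $\eta(\varsigma,\iota,i,s)=\iota(i)(s)$ for inputs; $\mathrm{init}_s$ for cells at $i=0$; $\eta(\varsigma,\iota,i-1,\varsigma(i-1)(s))$ for cells at $i>0$; $\eta(\varsigma,\iota,i,f\tau_1\cdots\tau_n)=\langle f\rangle(\eta(\cdot,\tau_1),\dots)$.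 HyperTSL: $\varphi::=\forall\pi.\varphi\mid\exists\pi.\varphi\mid\psi$, $\psi::=\neg\psi\mid\psi\wedge\psi\mid X\psi\mid\psi U\psi\mid(\tau^p)_\pi\mid[c\leftarrow\tau]_\pi$, evaluated over a set $E$ of executions: $[c\leftarrow\tau]_\pi$ holds at $i$ iff $\varsigma(i)(c)$ is syntactically $\tau$ for $(\varsigma,\iota)=\Pi(\pi)$; $(\tau^p)_\pi$ iff $\eta(\varsigma,\iota,i,\tau^p)$ true; LTL connectives as usual; quantifiers range over $E$; $E\models_{\langle\cdot\rangle}\varphi$ at time 0 with empty assignment. HyperLTL: same shape over traces $(2^{AP})^\omega$ with atoms $a_\pi$, $T\models\varphi$ for trace sets $T$. Translation: fresh propositions $a_\tau$ for $\tau\in T_P\cup T_U$; $T_U^c$ = update terms in $T_U$ for cell $c$; $\mathit{cellProps}_\pi:=G\bigwedge_{c\in\mathbb C}\bigvee_{u\in T_U^c}((a_u)_\pi\wedge\bigwedge_{u'\in T_U^c\setminus\{u\}}\neg(a_{u'})_\pi)$. For $\varphi=Q_1\pi_1\cdots Q_n\pi_n.\psi$, $\mathrm{transl}(\varphi)=Q_1\pi_1\cdots Q_n\pi_n.\psi'\wedge\bigwedge_j\mathit{cellProps}_{\pi_j}$, where $\psi'$ replaces each $(\tau)_\pi$ by $(a_\tau)_\pi$. Pseudo hyperproperty: a HyperLTL formula $\chi$ over $AP$ describes one iff there is a set $P$ of traces with $T\models\chi\iff T\subseteq P$ for all trace sets $T$. A HyperTSL formula $\varphi$ describes one (over executions over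 $T_U$) iff for every interpretation $\langle\cdot\rangle$ there is a set $P$ of executions such that for every set $E$ of executions over $T_U$, $E\models_{\langle\cdot\rangle}\varphi\iff E\subseteq P$. *)

(* Defs.v *)
From HB Require Import structures.
From mathcomp Require Import all_boot.
From mathcomp Require Import finmap.
From mathcomp Require Import boolp classical_sets.

Set Implicit Arguments.
Unset Strict Implicit.
Unset Printing Implicit Defensive.

Local Open Scope classical_set_scope.

Definition var := nat.

(* Trace assignments are partial maps; an atom indexed by an unassigned
   variable is false, so that satisfaction is total on open formulas too. *)
Definition assignment (X : Type) := var -> option X.

Definition empty_assignment {X : Type} : assignment X := fun=> None.

Definition upd_assignment {X : Type} (Pi : assignment X) (pi : var) (x : X) :
  assignment X := fun pi' => if pi' == pi then Some x else Pi pi'.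

Definition holds_at {X : Type} (Pi : assignment X) (pi : var) (Q : X -> Prop) :
  Prop := if Pi pi is Some x then Q x else False.

(** * HyperLTL *)

(* LTrue is primitive because the empty conjunctions and disjunctions that
   arise in the translation cannot be written when there are no atoms. *)
Inductive ltl (A : Type) : Type :=
| LTrue
| LAtom of A & var
| LNot of ltl A
| LAnd of ltl A & ltl A
| LNext of ltl A
| LUntil of ltl A & ltl A.

Arguments LTrue {A}.

Inductive hyperltl (A : Type) : Type :=
| LForall of var & hyperltl A
| LExists of var & hyperltl A
| LBody of ltl A.

Definition LFalse {A : Type} : ltl A := LNot LTrue.
Definition LOr {A : Type} (p q : ltl A) : ltl A := LNot (LAnd (LNot p) (LNot q)).
Definition LGlobally {A : Type} (p : ltl A) : ltl A := LNot (LUntil LTrue (LNot p)).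
Definition LBigAnd {A : Type} (s : seq (ltl A)) : ltl A := foldr (@LAnd A) LTrue s.
Definition LBigOr {A : Type} (s : seq (ltl A)) : ltl A := foldr LOr LFalse s.

Definition trace (A : Type) := nat -> set A.

Definition traces_over {A : Type} (AP : set A) : set (trace A) :=
  [set t | forall i, t i `<=` AP].

Fixpoint ltl_sat {A : Type} (Pi : assignment (trace A)) (i : nat) (psi : ltl A) :
  Prop :=
  match psi with
  | LTrue => True
  | LAtom a pi => holds_at Pi pi (fun t => t i a)
  | LNot p => ~ ltl_sat Pi i p
  | LAnd p q => ltl_sat Pi i p /\ ltl_sat Pi i q
  | LNext p => ltl_sat Pi i.+1 p
  | LUntil p q => exists2 k, i <= k &
      ltl_sat Pi k q /\ forall j, i <= j < k -> ltl_sat Pi j p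
  end.

Fixpoint hyperltl_sat {A : Type} (T : set (trace A)) (Pi : assignment (trace A))
  (i : nat) (chi : hyperltl A) : Prop :=
  match chi with
  | LForall pi chi' =>
      forall t, T t -> hyperltl_sat T (upd_assignment Pi pi t) i chi'
  | LExists pi chi' =>
      exists2 t, T t & hyperltl_sat T (upd_assignment Pi pi t) i chi'
  | LBody psi => ltl_sat Pi i psi
  end.

Definition hyperltl_models {A : Type} (T : set (trace A)) (chi : hyperltl A) :
  Prop := hyperltl_sat T empty_assignment 0 chi.

Definition hyperltl_pseudo {A : Type} (AP : set A) (chi : hyperltl A) : Prop :=
  exists2 P : set (trace A), P `<=` traces_over AP &
    forall T : set (trace A), T `<=` traces_over AP ->
      (hyperltl_models T chi <-> T `<=` P).

(** * TSL *)

(* Predicate symbols are a subset of the function symbols. *)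
Record signature := Signature {
  input : Type;
  cell : finType;
  fsym : Type;
  arity : fsym -> nat;
  is_pred : pred fsym
}.

Inductive term (S : signature) : Type :=
| TInput of input S
| TCell of cell S
| TApp (f : fsym S) of {ffun 'I_(arity f) -> term S}.

HB.instance Definition _ (S : signature) := gen_eqMixin (term S).
HB.instance Definition _ (S : signature) := gen_choiceMixin (term S).

Definition is_pterm (S : signature) (t : term S) : bool :=
  if t is TApp p _ then is_pred p else false.

Definition pterm (S : signature) := {t : term S | is_pterm t}.

(* The pair (c, t) stands for [c <- t]. *)
Definition uterm (S : signature) : Type := (cell S * term S)%type.

HB.instance Definition _ (S : signature) := Choice.on (pterm S).
HB.instance Definition _ (S : signature) := Choice.on (uterm S).

(* [ofb] is the inclusion of the Booleans into the values. *)
Record interpretation (S : signature) (V : Type) (ofb : bool -> V) :=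
  Interpretation {
    interp : forall f : fsym S, {ffun 'I_(arity f) -> V} -> V;
    interp_pred : forall p : fsym S, is_pred p ->
      forall args, exists b : bool, @interp p args = ofb b
  }.

Definition computation (S : signature) := nat -> cell S -> term S.
Definition input_stream (S : signature) (V : Type) := nat -> input S -> V.
Definition execution (S : signature) (V : Type) : Type :=
  (computation S * input_stream S V)%type.

Definition executions_over {S : signature} {V : Type} (TU : {fset uterm S}) :
  set (execution S V) :=
  [set e | forall i (c : cell S), ((c, e.1 i c) : uterm S) \in TU].

Fixpoint eta {S : signature} {V : Type} {ofb : bool -> V}
  (I : interpretation S ofb) (init : cell S -> V) (e : execution S V)
  (i : nat) {struct i} : term S -> V :=
  fix ev (t : term S) : V :=
    match t with
    | TInput s => e.2 i s
    | TCell c => if i is j.+1 then eta I init e j (e.1 j c) else init c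
    | TApp f args => interp I [ffun k => ev (args k)]
    end.

(** * HyperTSL *)

Inductive tsl (S : signature) : Type :=
| TPred of pterm S & var
| TUpd of uterm S & var
| TNot of tsl S
| TAnd of tsl S & tsl S
| TNext of tsl S
| TUntil of tsl S & tsl S.

Inductive hypertsl (S : signature) : Type :=
| TForall of var & hypertsl S
| TExists of var & hypertsl S
| TBody of tsl S.

Fixpoint tsl_sat {S : signature} {V : Type} {ofb : bool -> V}
  (I : interpretation S ofb) (init : cell S -> V)
  (Pi : assignment (execution S V)) (i : nat) (psi : tsl S) : Prop :=
  match psi with
  | TPred p pi => holds_at Pi pi (fun e => eta I init e i (val p) = ofb true)
  | TUpd u pi => holds_at Pi pi (fun e => e.1 i u.1 = u.2)
  | TNot p => ~ tsl_sat I init Pi i p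
  | TAnd p q => tsl_sat I init Pi i p /\ tsl_sat I init Pi i q
  | TNext p => tsl_sat I init Pi i.+1 p
  | TUntil p q => exists2 k, i <= k &
      tsl_sat I init Pi k q /\ forall j, i <= j < k -> tsl_sat I init Pi j p
  end.

Fixpoint hypertsl_sat {S : signature} {V : Type} {ofb : bool -> V}
  (I : interpretation S ofb) (init : cell S -> V) (E : set (execution S V))
  (Pi : assignment (execution S V)) (i : nat) (phi : hypertsl S) : Prop :=
  match phi with
  | TForall pi phi' =>
      forall e, E e -> hypertsl_sat I init E (upd_assignment Pi pi e) i phi'
  | TExists pi phi' =>
      exists2 e, E e & hypertsl_sat I init E (upd_assignment Pi pi e) i phi'
  | TBody psi => tsl_sat I init Pi i psi
  end.

Definition hypertsl_models {S : signature} {V : Type} {ofb : bool -> V}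
  (I : interpretation S ofb) (init : cell S -> V) (E : set (execution S V))
  (phi : hypertsl S) : Prop := hypertsl_sat I init E empty_assignment 0 phi.

Definition hypertsl_pseudo {S : signature} {V : Type} (ofb : bool -> V)
  (init : cell S -> V) (TU : {fset uterm S}) (phi : hypertsl S) : Prop :=
  forall I : interpretation S ofb, exists P : set (execution S V),
    forall E : set (execution S V), E `<=` executions_over TU ->
      (hypertsl_models I init E phi <-> E `<=` P).

Fixpoint tsl_pterms {S : signature} (psi : tsl S) : seq (pterm S) :=
  match psi with
  | TPred p _ => [:: p]
  | TUpd _ _ => [::]
  | TNot p | TNext p => tsl_pterms p
  | TAnd p q | TUntil p q => tsl_pterms p ++ tsl_pterms q
  end.

Fixpoint tsl_uterms {S : signature} (psi : tsl S) : seq (uterm S) :=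
  match psi with
  | TPred _ _ => [::]
  | TUpd u _ => [:: u]
  | TNot p | TNext p => tsl_uterms p
  | TAnd p q | TUntil p q => tsl_uterms p ++ tsl_uterms q
  end.

Fixpoint matrix {S : signature} (phi : hypertsl S) : tsl S :=
  match phi with
  | TForall _ phi' | TExists _ phi' => matrix phi'
  | TBody psi => psi
  end.

Fixpoint quantified_vars {S : signature} (phi : hypertsl S) : seq var :=
  match phi with
  | TForall pi phi' | TExists pi phi' => pi :: quantified_vars phi'
  | TBody _ => [::]
  end.

(** * Translation *)

(* The fresh proposition a_tau, for tau a predicate or an update term. *)
Inductive prop (S : signature) : Type :=
| AProp of pterm S
| AUpd of uterm S.

Definition APset {S : signature} (TP : {fset pterm S}) (TU : {fset uterm S}) :
  set (prop S) :=
  [set a | match a with AProp p => p \in TP | AUpd u => u \in TU end].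

Definition updates_of {S : signature} (TU : {fset uterm S}) (c : cell S) :
  {fset uterm S} := [fset u in TU | u.1 == c]%fset.

Definition cell_props {S : signature} (TU : {fset uterm S}) (pi : var) :
  ltl (prop S) :=
  LGlobally (LBigAnd [seq
    LBigOr [seq
      LAnd (LAtom (AUpd u) pi)
           (LBigAnd [seq LNot (LAtom (AUpd u') pi)
                    | u' <- enum_fset (updates_of TU c `\ u)%fset])
      | u <- enum_fset (updates_of TU c)]
    | c <- enum (cell S)]).

Fixpoint transl_tsl {S : signature} (psi : tsl S) : ltl (prop S) :=
  match psi with
  | TPred p pi => LAtom (AProp p) pi
  | TUpd u pi => LAtom (AUpd u) pi
  | TNot p => LNot (transl_tsl p)
  | TAnd p q => LAnd (transl_tsl p) (transl_tsl q)
  | TNext p => LNext (transl_tsl p)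
  | TUntil p q => LUntil (transl_tsl p) (transl_tsl q)
  end.

Fixpoint with_matrix {S : signature} {A : Type} (phi : hypertsl S) (psi : ltl A) :
  hyperltl A :=
  match phi with
  | TForall pi phi' => LForall pi (with_matrix phi' psi)
  | TExists pi phi' => LExists pi (with_matrix phi' psi)
  | TBody _ => LBody psi
  end.

Definition transl {S : signature} (TU : {fset uterm S}) (phi : hypertsl S) :
  hyperltl (prop S) :=
  with_matrix phi
    (LAnd (transl_tsl (matrix phi))
          (LBigAnd [seq cell_props TU pi | pi <- quantified_vars phi])).

(* Main.v *)
Require Import Defs.
From mathcomp Require Import all_boot.
From mathcomp Require Import finmap.
From mathcomp Require Import boolp classical_sets.

(** Abstract an execution [e] to the trace of the propositions that hold along
    it. A set of executions over [TU] satisfies [phi] iff its image satisfies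
    [transl TU phi]: the atoms agree, and [cell_props] holds on the image because
    a computation assigns exactly one term to each cell. Hence the preimage of
    the trace set witnessing the pseudo hyperproperty [transl TU phi] is a
    witness for [phi]. *)

Set Implicit Arguments.
Unset Strict Implicit.
Unset Printing Implicit Defensive.

Local Open Scope classical_set_scope.

Lemma ltl_sat_bigand (A : Type) (Pi : assignment (trace A)) (i : nat)
    (J : eqType) (F : J -> ltl A) (s : seq J) :
  ltl_sat Pi i (LBigAnd (map F s)) <-> {in s, forall j, ltl_sat Pi i (F j)}.
Proof.
elim: s => [|j s IHs] //=; rewrite IHs; split=> [[Fj Fs] k | Fs].
  by rewrite inE => /predU1P[-> //|]; exact: Fs.
by split=> [|k ks]; apply: Fs; rewrite inE ?eqxx // ks orbT.
Qed.

Lemma ltl_sat_bigor (A : Type) (Pi : assignment (trace A)) (i : nat)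
    (J : eqType) (F : J -> ltl A) (s : seq J) (j : J) :
  j \in s -> ltl_sat Pi i (F j) -> ltl_sat Pi i (LBigOr (map F s)).
Proof.
elim: s => [|k s IHs] //=; rewrite inE => /predU1P[<- Fj [] // | js Fj [_]].
by apply; exact: IHs.
Qed.

Lemma ltl_sat_globally (A : Type) (Pi : assignment (trace A)) (i : nat)
    (psi : ltl A) :
  (forall k, ltl_sat Pi k psi) -> ltl_sat Pi i (LGlobally psi).
Proof. by move=> psiT [k _ [/(_ (psiT k))]]. Qed.

Section ExecutionTrace.
Variables (S : signature) (V : Type) (ofb : bool -> V).
Variables (I : interpretation S ofb) (init : cell S -> V).
Variables (TP : {fset pterm S}) (TU : {fset uterm S}).

(** The conjuncts [p \in TP] and [u \in TU] keep the trace inside [APset TP TU], the only traces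
    about which the hypothesis on [transl TU phi] speaks. *)
Definition execution_trace (e : execution S V) : trace (prop S) := fun i =>
  [set a | match a with
           | AProp p => p \in TP /\ eta I init e i (val p) = ofb true
           | AUpd u => u \in TU /\ e.1 i u.1 = u.2
           end].

Lemma execution_trace_over (e : execution S V) :
  traces_over (APset TP TU) (execution_trace e).
Proof. by move=> i [p|u] []. Qed.

(** Unassigned variables stay unassigned, so atoms indexed by them are false on both sides. *)
Definition trace_assignment (Pi : assignment (execution S V)) :
  assignment (trace (prop S)) := fun pi => omap execution_trace (Pi pi).

Lemma trace_assignment_upd Pi pi e :
  trace_assignment (upd_assignment Pi pi e) =
  upd_assignment (trace_assignment Pi) pi (execution_trace e).
Proof.
by apply/funext => v; rewrite /trace_assignment /upd_assignment; case: eqP.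
Qed.

Lemma holds_at_trace Pi pi Q :
  holds_at (trace_assignment Pi) pi Q <->
  holds_at Pi pi (fun e => Q (execution_trace e)).
Proof. by rewrite /holds_at /trace_assignment; case: (Pi pi). Qed.

Lemma ltl_sat_transl_tsl Pi i psi :
  {subset tsl_pterms psi <= TP} -> {subset tsl_uterms psi <= TU} ->
  ltl_sat (trace_assignment Pi) i (transl_tsl psi) <-> tsl_sat I init Pi i psi.
Proof.
elim: psi i => [p pi|u pi|psi IH|psi1 IH1 psi2 IH2|psi IH|psi1 IH1 psi2 IH2] i
  /= sP sU.
- rewrite holds_at_trace /holds_at; case: (Pi pi) => //= e.
  by split=> [[]|] //; split=> //; apply: sP; rewrite inE.
- rewrite holds_at_trace /holds_at; case: (Pi pi) => //= e.
  by split=> [[]|] //; split=> //; apply: sU; rewrite inE.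
- by rewrite IH.
- by rewrite IH1 ?IH2 // => x xs; (apply: sP || apply: sU);
    rewrite mem_cat xs ?orbT.
- exact: IH.
- have {}IH1 k : ltl_sat (trace_assignment Pi) k (transl_tsl psi1) <->
                 tsl_sat I init Pi k psi1.
    by apply: IH1 => x xs; (apply: sP || apply: sU); rewrite mem_cat xs.
  have {}IH2 k : ltl_sat (trace_assignment Pi) k (transl_tsl psi2) <->
                 tsl_sat I init Pi k psi2.
    by apply: IH2 => x xs; (apply: sP || apply: sU); rewrite mem_cat xs orbT.
  by split=> -[k ik [/IH2 ? H]]; exists k => //; split=> // j /H /IH1.
Qed.

Lemma ltl_sat_cell_props Pi i pi e :
  Pi pi = Some e -> executions_over TU e ->
  ltl_sat (trace_assignment Pi) i (cell_props TU pi).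
Proof.
move=> Pie eTU; apply: ltl_sat_globally => k.
apply/ltl_sat_bigand => c _.
(* The true disjunct is the update that [e] performs on [c] at time [k]; it lies in [TU] because [e]
   is over [TU]. *)
apply: (@ltl_sat_bigor _ _ _ _ _ _ ((c, e.1 k c) : uterm S)).
  by rewrite /updates_of !inE /= eTU eqxx.
split; first by rewrite /= holds_at_trace /holds_at Pie /=.
apply/ltl_sat_bigand => -[c' t].
(* If the atom of a competing update of [c] held too, both updates would carry the term [e.1 k c]
   and so coincide, against [ne]. *)
rewrite /updates_of !inE /= => /and3P[ne _ /eqP ec].
rewrite holds_at_trace /holds_at Pie /= => -[_ et].
by rewrite -et ec eqxx in ne.
Qed.

(** The conjunction of [cell_props] ranges over all variables of the original prefix, while
    induction strips quantifiers from [phi]. Hence [vs] is a separate parameter, with the invariant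
    that each of its variables is still to be quantified or already bound to an execution in [E]. *)
Lemma hyperltl_sat_transl (E : set (execution S V)) (phi : hypertsl S)
    (Pi : assignment (execution S V)) (i : nat) (vs : seq var) :
  E `<=` executions_over TU ->
  {subset tsl_pterms (matrix phi) <= TP} ->
  {subset tsl_uterms (matrix phi) <= TU} ->
  {in vs, forall v, v \in quantified_vars phi \/
                    exists2 e, E e & Pi v = Some e} ->
  hyperltl_sat (execution_trace @` E) (trace_assignment Pi) i
    (with_matrix phi (LAnd (transl_tsl (matrix phi))
                           (LBigAnd [seq cell_props TU v | v <- vs]))) <->
  hypertsl_sat I init E Pi i phi.
Proof.
move=> ETU.
(* Passing under a quantifier preserves the invariant: the variable just bound moves to the second
   alternative. *)
have upd_assigned (psi : hypertsl S) pi (Pi' : assignment _) e : E e ->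
    {in vs, forall v, v \in pi :: quantified_vars psi \/
                      exists2 e, E e & Pi' v = Some e} ->
    {in vs, forall v, v \in quantified_vars psi \/
              exists2 e', E e' & upd_assignment Pi' pi e v = Some e'}.
  move=> Ee vsP v /vsP; rewrite inE /upd_assignment.
  by case: eqP => [_ _|_ //]; right; exists e.
elim: phi Pi => [pi phi IH|pi phi IH|psi] Pi /= sP sU vsP.
- have {}IH e (Ee : E e) := IH _ sP sU (upd_assigned _ _ _ _ Ee vsP).
  split=> [H e Ee|H _ [e Ee <-]].
    by apply/IH; rewrite // trace_assignment_upd; apply: H; exists e.
  by rewrite -trace_assignment_upd IH //; exact: H.
- have {}IH e (Ee : E e) := IH _ sP sU (upd_assigned _ _ _ _ Ee vsP).
  split=> [[_ [e Ee <-]]|[e Ee] H].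
    by rewrite -trace_assignment_upd IH // => ?; exists e.
  exists (execution_trace e); first by exists e.
  by rewrite -trace_assignment_upd IH.
(* At the matrix no quantifier is left, so every variable in [vs] is bound to an execution over [TU]
   and [cell_props] holds for it. *)
- rewrite ltl_sat_transl_tsl //; split=> [[]//|psiT]; split=> //.
  apply/ltl_sat_bigand => v /vsP[//|[e /ETU eTU Pie]].
  exact: ltl_sat_cell_props Pie eTU.
Qed.

Lemma hyperltl_models_transl (E : set (execution S V)) (phi : hypertsl S) :
  E `<=` executions_over TU ->
  {subset tsl_pterms (matrix phi) <= TP} ->
  {subset tsl_uterms (matrix phi) <= TU} ->
  hyperltl_models (execution_trace @` E) (transl TU phi) <->
  hypertsl_models I init E phi.
Proof.
move=> ETU sP sU.
(* At the start every variable is still to be quantified. *)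
by apply: (@hyperltl_sat_transl E phi empty_assignment 0 (quantified_vars phi))
  => // v; left.
Qed.

End ExecutionTrace.

Theorem theorem4 (S : signature) (V : Type) (ofb : bool -> V)
  (ofb_inj : injective ofb) (init : cell S -> V)
  (TP : {fset pterm S}) (TU : {fset uterm S}) (phi : hypertsl S)
  (phi_TP : {subset tsl_pterms (matrix phi) <= TP})
  (phi_TU : {subset tsl_uterms (matrix phi) <= TU}) :
  hyperltl_pseudo (APset TP TU) (transl TU phi) ->
  hypertsl_pseudo ofb init TU phi.
Proof.
(* [P] is fixed before [I]; the interpretation enters only through the map whose preimage is
   taken. *)
move=> [P _ transl_P] I; exists (execution_trace I init TP TU @^-1` P) => E ETU.
rewrite -(hyperltl_models_transl I init ETU phi_TP phi_TU) transl_P.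
  exact: image_subP.
by move=> _ [e _ <-]; exact: execution_trace_over.
Qed.
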